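(* Let $p$ be an odd prime, let $q\in\mathbb{C}_p$ with $|q-1|_p<p^{-1/(p-1)}$, and let $h\in\mathbb{Z}$. For all positive integers $n,v$ and all $y_1,y_2,\dots,y_v\in\mathbb{C}_p$, $$E_{n,q}^{(h,v)}(y_1+y_2+\cdots+y_v)=\sum_{\substack{l_1,l_2,\dots,l_v\ge 0\\ l_1+l_2+\cdots+l_v=n}}\binom{n}{l_1,l_2,\dots,l_v}\prod_{j=1}^{v}E_{l_j,q}^{(h)}(y_j).$$
   Context: $\mathbb{C}_p$ is the completion of an algebraic closure of $\mathbb{Q}_p$, with absolute value normalized by $|p|_p=p^{-1}$. For $x\in\mathbb{Z}_p$, $q^{x}=\exp(x\log q)$. Fermionic integral: for a uniformly differentiable function $f:\mathbb{Z}_p\to\mathbb{C}_p$, $\int_{\mathbb{Z}_p} f(x)\,d\mu_{-1}(x)=\lim_{N\to\infty}\sum_{x=0}^{p^N-1}f(x)(-1)^x$. Multiple integrals are iterated integrals. The $(h,q)$-extension of Euler polynomials $E_{n,q}^{(h)}(x)$ is defined by the generating function $$\frac{2e^{tx}}{q^{h}e^{t}+1}=\sum_{n=0}^{\infty}E_{n,q}^{(h)}(x)\frac{t^n}{n!}.$$ The higher-order $(h,q)$-Euler polynomials $E_{n,q}^{(h,v)}(z)$ ($v$ a positive integer, $z\in\mathbb{C}_p$) are defined, for $t\in\mathbb{C}_p$ sufficiently close to $0$, by $$\int_{\mathbb{Z}_p}\cdots\int_{\mathbb{Z}_p}q^{\sum_{j=1}^{v}hx_j}\exp\Big(tz+\sum_{j=1}^{v}tx_j\Big)\prod_{j=1}^{v}d\mu_{-1}(x_j)=\sum_{n=0}^{\infty}E_{n,q}^{(h,v)}(z)\frac{t^n}{n!}$$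 ($v$-fold integral), equivalently by the generating function $e^{tz}\left(\frac{2}{q^{h}e^{t}+1}\right)^{v}=\sum_{n=0}^{\infty}E_{n,q}^{(h,v)}(z)\frac{t^n}{n!}$. The multinomial coefficient is $\binom{n}{l_1,\dots,l_v}=\frac{n!}{l_1!\cdots l_v!}$. *)

(* Defs.v *)
From HB Require Import structures.
From mathcomp Require Import all_boot all_order all_algebra.
From mathcomp Require Import all_classical all_reals all_analysis.

Set Implicit Arguments.
Unset Strict Implicit.
Unset Printing Implicit Defensive.

Import Order.TTheory GRing.Theory Num.Theory.

Local Open Scope classical_set_scope.
Local Open Scope ring_scope.

(* The norm of a MathComp normed module is homogeneous for the usual
   (archimedean) absolute value of the integers, so a p-adic field is not a
   normed module. Fields with a real-valued non-archimedean absolute value are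
   introduced here and made into metric spaces for |x - y|. *)

HB.mixin Record isUltrametricField (R : realType) C of GRing.Field C := {
  vabs : C -> R ;
  vabs0 : vabs 0 = 0 ;
  vabs0_eq0 : forall x : C, vabs x = 0 -> x = 0 ;
  vabs_ge0 : forall x : C, 0 <= vabs x ;
  vabsM : forall x y : C, vabs (x * y) = vabs x * vabs y ;
  vabsD_max : forall x y : C, vabs (x + y) <= Num.max (vabs x) (vabs y)
}.

#[short(type="ultrametricFieldType")]
HB.structure Definition UltrametricField (R : realType) :=
  { C of GRing.Field C & isUltrametricField R C }.

Section UltrametricTopology.
Context (R : realType) (C : ultrametricFieldType R).

Lemma vabs1 : vabs (1 : C) = 1.
Proof.
have v1 : vabs (1 : C) != 0.
  by apply/eqP => /vabs0_eq0 /eqP; rewrite oner_eq0.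
by apply: (mulfI v1); rewrite -vabsM !mulr1.
Qed.

Lemma vabsN (x : C) : vabs (- x) = vabs x.
Proof.
suff v : vabs (-1 : C) = 1 by rewrite -mulN1r vabsM v mul1r.
have /eqP : vabs (-1 : C) ^+ 2 = 1 by rewrite expr2 -vabsM mulrNN mulr1 vabs1.
rewrite sqrf_eq1 => /orP[/eqP //|/eqP v].
by have := vabs_ge0 (-1 : C); rewrite v ler0N1.
Qed.

Let vdist (x y : C) : R := vabs (x - y).

Let vdistxx x : vdist x x = 0. Proof. by rewrite /vdist subrr vabs0. Qed.

Let vdist_positivity x y : vdist x y = 0 -> x = y.
Proof. by move/vabs0_eq0/eqP; rewrite subr_eq0 => /eqP. Qed.

Let vdist_sym x y : vdist x y = vdist y x.
Proof. by rewrite /vdist -vabsN opprB. Qed.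

Let vdist_triangle y x z : vdist x z <= vdist x y + vdist y z.
Proof.
rewrite /vdist -(subrKA y) (le_trans (vabsD_max _ _))// ge_max.
by rewrite lerDl lerDr !vabs_ge0.
Qed.

HB.instance Definition _ := isPointed.Build C 0.
HB.instance Definition _ :=
  isMetric.Build R C vdistxx vdist_positivity vdist_sym vdist_triangle.

End UltrametricTopology.

(* The topological closure of the rationals; when C is complete and
   |p| = p^-1, it is the completion Q_p of (Q, |.|_p). *)
Definition Qp (R : realType) (C : ultrametricFieldType R) : set C :=
  closure (range (@ratr C)).

Definition Qp_algebraic (R : realType) (C : ultrametricFieldType R) : set C :=
  [set x | exists P : {poly C}, [/\ P != 0, forall i, Qp P`_i & root P x]].

(* C is a completion of an algebraic closure of Q_p, i.e. C is C_p: C is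
   complete, |p| = p^-1, and the elements of C algebraic over Q_p form an
   algebraically closed field (hence an algebraic closure of Q_p) which is dense
   in C. These conditions determine C up to isometric isomorphism. *)
Record is_padic_complex (R : realType) (p : nat) (C : ultrametricFieldType R) :
    Prop := IsPadicComplex {
  vabs_p : vabs (p%:R : C) = p%:R^-1 ;
  padic_complete : forall F : set_system C, ProperFilter F -> cauchy F -> cvg F ;
  Qp_algebraic_closed : forall P : {poly C},
    (1 < size P)%N -> (forall i, Qp_algebraic P`_i) ->
    exists2 x : C, Qp_algebraic x & root P x ;
  Qp_algebraic_dense : closure (@Qp_algebraic R C) = setT
}.

Definition Zp (R : realType) (C : ultrametricFieldType R) : set C :=
  [set x | Qp x /\ vabs x <= 1].

Arguments Zp {R} C _.

Lemma Zp_nat (R : realType) (C : ultrametricFieldType R) (n : nat) :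
  Zp C n%:R.
Proof.
split.
  by apply: subset_closure; exists n%:R => //; rewrite -[n%:R]/(n%:~R) ratr_int.
elim: n => [|n IHn]; first by rewrite vabs0.
by rewrite -natr1 (le_trans (vabsD_max _ _))// ge_max IHn vabs1 lexx.
Qed.

Section Euler.
Context (R : realType) (p : nat) (C : ultrametricFieldType R).

Definition nat_Zp (n : nat) : Zp C := SigSub (mem_set (@Zp_nat R C n)).

(* The fermionic integral of f over Z_p. The limit exists for uniformly
   differentiable f; otherwise the value is that of [lim] by default. *)
Definition fermionic (f : Zp C -> C) : C :=
  limn (fun N => \sum_(0 <= x < p ^ N) f (nat_Zp x) * (-1) ^+ x).

Fixpoint fermionic_iter (v : nat) : (v.-tuple (Zp C) -> C) -> C :=
  if v is v'.+1 then fun f =>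
    fermionic (fun x => fermionic_iter (fun xs => f [tuple of x :: xs]))
  else fun f => f [tuple].

Definition pexp (x : C) : C :=
  limn (series (fun n => x ^+ n / (n`!)%:R)).

(* The series log x = \sum_(k >= 1) (-1) ^ (k - 1) * (x - 1) ^ k / k. *)
Definition plog (x : C) : C :=
  limn (series (fun n => (-1) ^+ n * (x - 1) ^+ n.+1 / n.+1%:R)).

(* q ^ x for x in Z_p; in particular for an integer x = h%:~R. *)
Definition qpow (q x : C) : C := pexp (x * plog q).

(* F(t) = \sum_n a_n t^n / n! for all t sufficiently close to 0. *)
Definition is_egf (F : C -> C) (a : nat -> C) : Prop :=
  \forall t \near (0 : C),
    series (fun n => a n * (t ^+ n / (n`!)%:R)) @ \oo --> F t.

(* The sequence of which F is the exponential generating function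
   (unspecified if F has no such expansion at 0). *)
Definition egf_coef (F : C -> C) : nat -> C := get (is_egf F).

Definition euler (q : C) (h : int) (n : nat) (x : C) : C :=
  egf_coef (fun t => 2 * pexp (t * x) / (qpow q h%:~R * pexp t + 1)) n.

Definition euler_higher (q : C) (h : int) (v n : nat) (z : C) : C :=
  egf_coef (fun t => fermionic_iter (fun x : v.-tuple (Zp C) =>
    qpow q (\sum_(j < v) h%:~R * set_val (tnth x j)) *
    pexp (t * z + \sum_(j < v) t * set_val (tnth x j)))) n.

End Euler.

(* The quotient is exact when l_1 + ... + l_v = n. *)
Definition multinomial (n v : nat) (l : 'I_v -> nat) : nat :=
  n`! %/ \prod_(j < v) (l j)`!.

(* Main.v *)
Require Import Defs.
From mathcomp Require Import all_boot all_order all_algebra.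
From mathcomp Require Import all_classical all_reals all_analysis.
From mathcomp Require Import ring zify.

(** Both sides of the identity are coefficients of one power series. Put
    w = q^h = exp (h log q). When every variable of the v-fold fermionic
    integral runs over natural numbers, which are the only points where the
    integrand is sampled, the integrand is e^(tz) times u^(x_1 + ... + x_v) with
    u = w e^t. A single integral of u^x is the limit of the geometric sums
      \sum_(x < p^N) (-u)^x = (1 + u^(p^N)) / (1 + u),
    where the sign comes from p being odd; since u = exp (h log q + t) and
    p^N (h log q + t) tends to 0, the limit is 2 / (1 + u)
    (fermionic_geometric). Iterating gives e^(tz) (2 / (w e^t + 1))^v for every
    small t (fermionic_iter_euler). With z = y_1 + ... + y_v this is the product
    over j of 2 e^(t y_j) / (w e^t + 1), the generating functions of the
    polynomials E_l(y_j), and comparing coefficients of t^n / n! yields the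
    multinomial sum.

    The generating functions have to be actual functions near 0 with unique
    expansions, so three analytic facts carry the argument.

    - The exponential series converges for |x| < rho = p^(-1/(p-1)) and is
      additive there (cvg_pexp, pexpD). Everything rests on the bound
      |(n+1)!| >= rho^n, a form of Legendre's formula (vabs_fact_ge); it also
      yields |log q| <= |q - 1| < rho, so that q^h is defined
      (vabs_plog_le).
    - Functions with an expansion at 0 whose coefficients grow at most
      geometrically are stable under sums, products and inverses
      (has_pseriesD, has_pseriesM, has_pseriesV). In the ultrametric setting
      the Cauchy product converges because its partial sums differ from the
      products of partial sums by terms that are each geometrically small.
    - A power series that vanishes near 0 is zero (pseries_eq0), hence
      egf_coef returns the coefficients of any expansion exhibited
      (egf_coefE). *)

Set Implicit Arguments.
Unset Strict Implicit.
Unset Printing Implicit Defensive.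

Import Order.TTheory GRing.Theory Num.Theory.
Import numFieldNormedType.Exports.

Local Open Scope ring_scope.

(** * Ultrametric absolute values *)

Section AbsoluteValue.
Context {R : realType} {C : ultrametricFieldType R}.
Implicit Types x y : C.

Lemma vabsX x n : vabs (x ^+ n) = vabs x ^+ n.
Proof. by elim: n => [|n IHn]; rewrite ?expr0 ?vabs1// !exprS vabsM IHn. Qed.

Lemma vabs_gt0 x : x != 0 -> 0 < vabs x.
Proof.
by move=> x0; rewrite lt_def vabs_ge0 andbT; apply: contra_neq x0 => /vabs0_eq0.
Qed.

Lemma vabsV x : vabs x^-1 = (vabs x)^-1.
Proof.
have [->|x0] := eqVneq x 0; first by rewrite invr0 vabs0 invr0.
have vx := vabs_gt0 x0.
by apply: (mulIf (lt0r_neq0 vx)); rewrite -vabsM !mulVf ?vabs1 ?gt_eqF.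
Qed.

Lemma vabs_sum_le (I : Type) (r : seq I) (P : pred I) (F : I -> C) (M : R) :
  0 <= M -> (forall i, P i -> vabs (F i) <= M) ->
  vabs (\sum_(i <- r | P i) F i) <= M.
Proof.
move=> M0 FM; elim/big_ind: _ => //; first by rewrite vabs0.
by move=> x y xM yM; rewrite (le_trans (vabsD_max _ _))// ge_max xM.
Qed.

Lemma vabs_sum_lt (I : Type) (r : seq I) (F : I -> C) (M : R) :
  0 < M -> (forall i, vabs (F i) < M) -> vabs (\sum_(i <- r) F i) < M.
Proof.
move=> M0 FM; elim/big_ind: _ => //; first by rewrite vabs0.
by move=> x y xM yM; rewrite (le_lt_trans (vabsD_max _ _))// gt_max xM.
Qed.

Lemma vabs_nat_le1 n : vabs (n%:R : C) <= 1.
Proof. by have [] := @Defs.Zp_nat R C n. Qed.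

Lemma vabs_int_le1 (m : int) : vabs (m%:~R : C) <= 1.
Proof.
case: m => m; first exact: vabs_nat_le1.
by rewrite NegzE mulrNz vabsN vabs_nat_le1.
Qed.

Lemma vabs_nat_mul n x : vabs (n%:R * x) <= vabs x.
Proof. by rewrite vabsM ler_piMl ?vabs_ge0 ?vabs_nat_le1. Qed.

(** In an ultrametric triangle the two longest sides are equal. *)
Lemma vabsB_lt_eq x y : vabs (x - y) < vabs y -> vabs x = vabs y.
Proof.
move=> xy; apply/eqP; rewrite eq_le; apply/andP; split.
  by rewrite -[x](subrK y) (le_trans (vabsD_max _ _))// ge_max (ltW xy) lexx.
have: vabs y <= Num.max (vabs (x - y)) (vabs x).
  by rewrite -[in leLHS](subKr x y) (le_trans (vabsD_max _ _))// vabsN maxC.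
by rewrite le_max leNgt xy.
Qed.

End AbsoluteValue.

(** * Limits of sequences *)

Section Convergence.
Context {R : realType} {C : ultrametricFieldType R}.
Implicit Types (x y l : C) (u w : nat -> C).
Local Open Scope classical_set_scope.

(** Reduces limits in C to limits of real numbers, where the algebra of limits
    is available. *)
Lemma cvg_vabsP u l :
  (u @ \oo --> l) <-> ((fun n => vabs (u n - l)) @ \oo --> (0 : R)).
Proof.
split=> [/cvg_ballP ul|/cvgrPdist_lt ul].
  apply/cvgrPdist_lt => e e0; near=> n.
  rewrite sub0r normrN ger0_norm ?vabs_ge0// -vabsN opprB.
  by near: n; exact: ul.
apply/cvg_ballP => e e0; near=> n; rewrite ballEmdist /=.
change (vabs (l - u n) < e); rewrite -vabsN opprB.
have : `|0 - vabs (u n - l)| < e by near: n; exact: ul.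
by rewrite sub0r normrN ger0_norm ?vabs_ge0.
Unshelve. all: by end_near. Qed.

Lemma cvg_vabs_le u l (d : nat -> R) :
  (\forall n \near \oo, vabs (u n - l) <= d n) -> d @ \oo --> 0 ->
  u @ \oo --> l.
Proof.
move=> ud d0; apply/cvg_vabsP/(squeeze_cvgr _ (cvg_cst 0) d0).
by near=> n; rewrite vabs_ge0; near: n.
Unshelve. all: by end_near. Qed.

Lemma ultra_cvg_unique u x y : u @ \oo --> x -> u @ \oo --> y -> x = y.
Proof.
by move=> ux uy; apply: (@cvg_unique _ (@metric_hausdorff R C) (u @ \oo) _).
Qed.

Lemma ultra_cvg_lim u l : u @ \oo --> l -> limn u = l.
Proof. by move=> ul; apply/cvg_lim => //; exact: (@metric_hausdorff R C). Qed.

Lemma ultra_cvgD u w x y :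
  u @ \oo --> x -> w @ \oo --> y -> (fun n => u n + w n) @ \oo --> x + y.
Proof.
move=> /cvg_vabsP ux /cvg_vabsP wy.
have d0 : (fun n => vabs (u n - x) + vabs (w n - y)) @ \oo --> (0 : R).
  by rewrite -[0]addr0; exact: cvgD.
apply: cvg_vabs_le d0; near=> n.
rewrite opprD addrACA (le_trans (vabsD_max _ _))// ge_max.
by rewrite lerDl lerDr !vabs_ge0.
Unshelve. all: by end_near. Qed.

Lemma ultra_cvgM u w x y :
  u @ \oo --> x -> w @ \oo --> y -> (fun n => u n * w n) @ \oo --> x * y.
Proof.
move=> /cvg_vabsP ux /cvg_vabsP wy.
have uM : (fun n => vabs (u n - x) * vabs (w n - y)) @ \oo --> 0.
  by rewrite -(mulr0 0); exact: cvgM.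
have xw : (fun n => vabs x * vabs (w n - y)) @ \oo --> 0.
  by rewrite -(mulr0 (vabs x)); apply: cvgM => //; exact: cvg_cst.
have uy : (fun n => vabs (u n - x) * vabs y) @ \oo --> 0.
  by rewrite -(mul0r (vabs y)); apply: cvgM => //; exact: cvg_cst.
have d0 : (fun n => vabs (u n - x) * vabs (w n - y) +
    (vabs x * vabs (w n - y) + vabs (u n - x) * vabs y)) @ \oo --> (0 : R).
  by rewrite -[0]addr0 -[X in _ --> _ + X]addr0; apply: cvgD => //; exact: cvgD.
apply: cvg_vabs_le d0; near=> n.
have -> : u n * w n - x * y =
    (u n - x) * (w n - y) + (x * (w n - y) + (u n - x) * y) by ring.
have tri (z t : C) : vabs (z + t) <= vabs z + vabs t.
  by rewrite (le_trans (vabsD_max _ _))// ge_max lerDl lerDr !vabs_ge0.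
rewrite (le_trans (tri _ _))// /= -!vabsM lerD2l; exact: tri.
Unshelve. all: by end_near. Qed.

Lemma ultra_lim_le u l x (M : R) :
  u @ \oo --> l -> (\forall n \near \oo, vabs (u n - x) <= M) ->
  vabs (l - x) <= M.
Proof.
move=> /cvg_vabsP ul uM.
have: (fun n => vabs (u n - l) + M) @ \oo --> (0 + M).
  by apply: cvgD ul _; exact: cvg_cst.
rewrite add0r => cM; rewrite -(cvg_lim _ cM)//.
apply: limr_ge; first by apply/cvg_ex; exists M.
near=> n.
have -> : l - x = (u n - x) - (u n - l) by ring.
have uMn : vabs (u n - x) <= M by near: n.
rewrite (le_trans (vabsD_max _ _))// vabsN ge_max lerDl.
by rewrite (le_trans (vabs_ge0 _) uMn) (le_trans uMn)// lerDr vabs_ge0.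
Unshelve. all: by end_near. Qed.

End Convergence.

(** * Series with geometrically bounded terms *)

Section UltrametricSeries.
Context {R : realType} {C : ultrametricFieldType R}.
Implicit Types (x y : C) (a b : nat -> C) (s A B : R).
Local Open Scope classical_set_scope.

Definition dominated A s a := forall n, vabs (a n) <= A * s ^+ n.

Lemma dominated_ge0 A s a : dominated A s a -> 0 <= A.
Proof.
by move=> /(_ 0%N); rewrite expr0 mulr1; exact: le_trans (vabs_ge0 _).
Qed.

(** By the ultrametric inequality a block of terms is no larger than the bound
    on its first term; no geometric sum is needed. *)
Lemma series_tail_le A s a n m : 0 <= s <= 1 -> dominated A s a -> (n <= m)%N ->
  vabs (series a m - series a n) <= A * s ^+ n.
Proof.
move=> /andP[s0 s1] dom nm; have A0 := dominated_ge0 dom.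
rewrite sub_series_geq// big_nat_cond; apply: vabs_sum_le.
  by rewrite mulr_ge0 ?exprn_ge0.
move=> i /andP[/andP[ni _] _]; apply: le_trans (dom i) _.
by rewrite ler_wpM2l// ler_wiXn2l.
Qed.

Lemma cvg_geometric0 A s : 0 <= s < 1 ->
  (fun n => A * s ^+ n) @ \oo --> (0 : R).
Proof. by move=> /andP[s0 s1]; apply: cvg_geometric; rewrite ger0_norm. Qed.

Lemma cvg_series_dominated A s a :
  (forall F : set_system C, ProperFilter F -> cauchy F -> cvg F) ->
  0 <= s < 1 -> dominated A s a -> series a @ \oo --> limn (series a).
Proof.
move=> complete /andP[s0 s1] dom.
suff : cauchy (series a @ \oo).
  by move=> /complete/cvg_ex[l al]; rewrite (ultra_cvg_lim al).
apply: cauchy_exP => e e0.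
have : \forall n \near \oo, A * s ^+ n < e.
  have /cvgrPdist_lt/(_ e e0) : (fun n => A * s ^+ n) @ \oo --> (0 : R).
    by apply: cvg_geometric0; rewrite s0.
  apply: filterS => n; rewrite sub0r normrN; apply: le_lt_trans.
  exact: ler_norm.
move=> [N _ /(_ N (leqnn N)) Ne].
exists (series a N); exists N => // m /= Nm.
rewrite ballEmdist; change (vabs (series a N - series a m) < e).
rewrite -vabsN opprB (le_lt_trans (series_tail_le _ dom Nm))//.
by rewrite s0 ltW.
Qed.

Definition cauchy_prod a b n := \sum_(k < n.+1) a k * b (n - k)%N.

(** Summing over the triangle k + i < n row by row. *)
Lemma series_cauchy_prod a b n :
  series (cauchy_prod a b) n = \sum_(k < n) a k * series b (n - k)%N.
Proof.
elim: n => [|n IHn]; first by rewrite /series /= big_geq// big_ord0.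
rewrite seriesSr IHn /cauchy_prod !big_ord_recr /= subnn subSn// subnn.
rewrite /series /= big_nat1 addrA -big_split /=; congr (_ + _).
apply: eq_bigr => k _; have kn := ltnW (ltn_ord k).
by rewrite -mulrDr subSn// big_nat_recr.
Qed.

Lemma dominated_cauchy_prod A B s a b :
  0 <= s -> dominated A s a -> dominated B s b ->
  dominated (A * B) s (cauchy_prod a b).
Proof.
move=> s0 da db n; have A0 := dominated_ge0 da; have B0 := dominated_ge0 db.
apply: vabs_sum_le => [|k _]; first by rewrite !mulr_ge0 ?exprn_ge0.
have -> : s ^+ n = s ^+ k * s ^+ (n - k) by rewrite -exprD subnKC// -ltnS.
by rewrite mulrACA vabsM ler_pM ?vabs_ge0.
Qed.

(** The product of the n-th partial sums exceeds the n-th partial sum of the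
    Cauchy product by the terms a_k b_i with k, i < n <= k + i, each of which
    is at most A B s^n; so the whole difference is. *)
Lemma cvg_series_cauchy_prod A B s a b x y : 0 <= s < 1 ->
  dominated A s a -> dominated B s b ->
  series a @ \oo --> x -> series b @ \oo --> y ->
  series (cauchy_prod a b) @ \oo --> x * y.
Proof.
move=> /andP[s0 s1] da db ax bY.
have A0 := dominated_ge0 da; have B0 := dominated_ge0 db.
have ab := ultra_cvgM ax bY.
have : (fun n => series (cauchy_prod a b) n - series a n * series b n) @ \oo -->
    (0 : C).
  have d0 : (fun n => A * B * s ^+ n) @ \oo --> (0 : R).
    by apply: cvg_geometric0; rewrite s0.
  apply: cvg_vabs_le d0; near=> n; rewrite subr0 series_cauchy_prod.
  rewrite {2}/series /= big_mkord mulr_suml -sumrB.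
  apply: vabs_sum_le => [|k _]; first by rewrite !mulr_ge0 ?exprn_ge0.
  have -> : s ^+ n = s ^+ k * s ^+ (n - k) by rewrite -exprD subnKC// ltnW.
  rewrite -mulrBr mulrACA vabsM ler_pM ?vabs_ge0// -vabsN opprB.
  by rewrite series_tail_le ?s0 ?ltW// leq_subr.
move=> /ultra_cvgD/(_ ab); rewrite add0r.
by apply: cvg_trans; apply: near_eq_cvg; near=> n; rewrite subrK.
Unshelve. all: by end_near. Qed.

End UltrametricSeries.

(** * The absolute value of factorials *)

Section PadicFactorial.

(** Legendre: with m = n %/ p, the valuation of n! is m plus that of m!, so by
    induction (p - 1) times it is less than (p - 1) m + m = p m <= n when m is
    positive, and it is 0 otherwise. The strictness gives the exponent n instead
    of n.+1 in the lower bound for |n.+1!|, without which |log q| could not be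
    kept inside the disc of convergence of the exponential. *)
Lemma logn_fact_lt (p n : nat) :
  prime p -> (0 < n)%N -> (p.-1 * logn p n`! < n)%N.
Proof.
move=> pp; have p0 := prime_gt0 pp; rewrite logn_fact//; move: n.+1 => L.
(* The bound holds for any number L of terms of Legendre's sum. *)
elim: L n => [|L IHL] n n0; first by rewrite big_geq// muln0.
case: L IHL => [_|L IHL]; first by rewrite big_geq// muln0.
rewrite big_add1 /= big_nat_recl// expn1.
have -> : (\sum_(0 <= i < L) n %/ p ^ i.+2 =
           \sum_(1 <= i < L.+1) (n %/ p) %/ p ^ i)%N.
  by rewrite big_add1; apply: eq_bigr => i _; rewrite expnS divnMA.
have := leq_divM n p; have := IHL (n %/ p)%N.
have [->|m0] := posnP (n %/ p)%N.
  move=> _ _; rewrite big1 ?addn0 ?muln0// => i _; exact: div0n.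
move=> /(_ isT) lt_m mn; apply: leq_trans mn.
rewrite mulnDr -[X in (_ < _ * X)%N](prednK p0) mulnS addnC.
by rewrite [X in (_ < _ + X)%N]mulnC ltn_add2r.
Qed.

Context {R : realType} {C : ultrametricFieldType R} (p : nat).
Context (p_prime : prime p) (vabs_p : vabs (p%:R : C) = p%:R^-1).

Let p_gt1 : 1 < (p%:R : R). Proof. by rewrite ltr1n prime_gt1. Qed.
Let p_gt0 : 0 < (p%:R : R). Proof. exact: lt_trans p_gt1. Qed.
Let vabs_p_lt1 : vabs (p%:R : C) < 1. Proof. by rewrite vabs_p invf_lt1. Qed.

(** A Bezout relation u m = 1 + w p forces |u m| = 1, and neither factor can
    exceed 1. *)
Lemma vabs_nat_coprime m : ~~ (p %| m)%N -> vabs (m%:R : C) = 1.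
Proof.
move=> pm; have m0 : (0 < m)%N by case: m pm; rewrite ?dvdn0.
have /(coprimeP _ m0)[[u w] /= uw] : coprime m p.
  by rewrite coprime_sym prime_coprime.
have v1 : vabs ((u * m)%:R : C) = 1.
  rewrite -(@vabs1 _ C); apply: vabsB_lt_eq; rewrite vabs1.
  have -> : (u * m = 1 + w * p)%N by lia.
  rewrite natrD addrAC subrr add0r natrM vabsM.
  by rewrite (le_lt_trans _ vabs_p_lt1)// ler_piMl ?vabs_ge0// vabs_nat_le1.
apply/eqP; rewrite eq_le vabs_nat_le1 /= -v1 natrM vabsM.
by rewrite ler_piMl ?vabs_ge0 ?vabs_nat_le1.
Qed.

Lemma vabs_nat m : (0 < m)%N -> vabs (m%:R : C) = p%:R^-1 ^+ logn p m.
Proof.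
move=> m0; have [k pk {1}->] := pfactor_coprime p_prime m0.
rewrite natrM vabsM natrX vabsX vabs_p vabs_nat_coprime ?mul1r//.
by rewrite -prime_coprime.
Qed.

(** In particular C has characteristic 0. *)
Lemma natr_neq0 m : (0 < m)%N -> (m%:R : C) != 0.
Proof.
move=> m0; apply: contraTneq isT => mE; have := vabs_nat m0.
by rewrite mE vabs0 => /esym/eqP; rewrite expf_eq0 invr_eq0 gt_eqF ?andbF.
Qed.

Definition exp_radius : R := p%:R `^ (- (p.-1%:R)^-1).

Lemma exp_radius_gt0 : 0 < exp_radius. Proof. exact: powR_gt0. Qed.

Lemma exp_radiusX : exp_radius ^+ p.-1 = p%:R^-1.
Proof.
have p1 : (p.-1%:R : R) != 0.
  by rewrite pnatr_eq0 -lt0n -subn1 subn_gt0 prime_gt1.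
by rewrite -powR_mulrn ?powR_ge0// -powRrM mulNr mulVf// powR_inv1// ltW.
Qed.

Lemma exp_radius_lt1 : exp_radius < 1.
Proof.
rewrite ltNge; apply/negP => /(exprn_ege1 p.-1).
by rewrite exp_radiusX leNgt invf_lt1 ?p_gt1.
Qed.

Lemma vabs_fact_ge n : exp_radius ^+ n <= vabs (n.+1`!%:R : C).
Proof.
rewrite vabs_nat ?fact_gt0// -exp_radiusX -exprM.
rewrite ler_wiXn2l ?ltW ?exp_radius_gt0 ?exp_radius_lt1//.
by rewrite -ltnS logn_fact_lt.
Qed.

(** Finer than dominated_exp by the factor |x| in place of
    |x| / exp_radius; it controls exp x - 1 and, as the n-th term of the
    logarithm is (n - 1)! times that of the exponential up to sign, log q. *)
Lemma vabs_exp_term_le (x : C) n :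
  vabs (x ^+ n.+1 / n.+1`!%:R) <= vabs x * (vabs x / exp_radius) ^+ n.
Proof.
have r0 := exp_radius_gt0.
rewrite vabsM vabsX vabsV exprS -mulrA expr_div_n ler_wpM2l ?vabs_ge0//.
rewrite ler_wpM2l ?exprn_ge0 ?vabs_ge0// lef_pV2 ?vabs_fact_ge// posrE.
  by rewrite vabs_gt0 ?natr_neq0 ?fact_gt0.
by rewrite exprn_gt0.
Qed.

Lemma dominated_exp (x : C) :
  dominated 1 (vabs x / exp_radius) (fun n => x ^+ n / n`!%:R).
Proof.
have r0 := exp_radius_gt0.
case=> [|n]; first by rewrite !expr0 fact0 invr1 !mulr1 vabs1.
rewrite mul1r (le_trans (vabs_exp_term_le _ _))// exprS ler_wpM2r//.
  by rewrite exprn_ge0// divr_ge0 ?vabs_ge0 ?ltW.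
by rewrite ler_peMr ?vabs_ge0// invf_ge1 ?(ltW exp_radius_lt1).
Qed.

End PadicFactorial.

(** * The exponential and the logarithm *)

Section Exponential.
Context {R : realType} {C : ultrametricFieldType R} (p : nat).
Context (p_prime : prime p) (vabs_p : vabs (p%:R : C) = p%:R^-1).
Context (complete :
  forall F : set_system C, ProperFilter F -> cauchy F -> cvg F).
Implicit Types (x y q : C).
Local Open Scope classical_set_scope.
Local Notation rho := (exp_radius p : R).

Let rho_gt0 : 0 < rho. Proof. exact: exp_radius_gt0. Qed.

Let ratio_bounds x : vabs x < rho -> 0 <= vabs x / rho < 1.
Proof. by move=> xr; rewrite divr_ge0 ?vabs_ge0 ?ltW//= ltr_pdivrMr ?mul1r. Qed.

Lemma cvg_pexp x : vabs x < rho ->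
  series (fun n => x ^+ n / n`!%:R) @ \oo --> pexp x.
Proof.
move=> /ratio_bounds xr; apply: cvg_series_dominated xr _ => //.
exact: dominated_exp.
Qed.

(** The binomial formula. *)
Lemma cauchy_prod_exp x y :
  cauchy_prod (fun n => x ^+ n / n`!%:R) (fun n => y ^+ n / n`!%:R) =
  (fun n => (x + y) ^+ n / n`!%:R).
Proof.
apply/funext => n; rewrite addrC exprDn mulr_suml; apply: eq_bigr => k _.
have kn : (k <= n)%N by rewrite -ltnS.
have nz m : (m`!%:R : C) != 0 by rewrite (natr_neq0 p_prime vabs_p)// fact_gt0.
rewrite -(bin_fact kn) !natrM -mulr_natr; field.
by rewrite !nz (natr_neq0 p_prime vabs_p)// bin_gt0.
Qed.

Lemma pexpD x y : vabs x < rho -> vabs y < rho ->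
  pexp (x + y) = pexp x * pexp y.
Proof.
move=> xr yr.
pose s := Num.max (vabs x) (vabs y) / rho.
have s01 : 0 <= s < 1.
  by rewrite /s; case: (leP (vabs x) (vabs y)) => _; exact: ratio_bounds.
have dom (z : C) : vabs z <= Num.max (vabs x) (vabs y) ->
    dominated 1 s (fun n => z ^+ n / n`!%:R).
  move=> zs n; apply: le_trans (dominated_exp p_prime vabs_p _ _) _.
  rewrite !mul1r.
  apply: lerXn2r; rewrite ?nnegrE; [|by case/andP: s01|].
    by rewrite divr_ge0 ?vabs_ge0// ltW.
  by rewrite ler_pM2r ?invr_gt0.
apply: ultra_cvg_lim; rewrite -cauchy_prod_exp.
apply: cvg_series_cauchy_prod s01 _ _ (cvg_pexp xr) (cvg_pexp yr); apply: dom.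
  by rewrite le_max lexx.
by rewrite le_max lexx orbT.
Qed.

Lemma vabs_pexpB1 x : vabs x < rho -> vabs (pexp x - 1) <= vabs x.
Proof.
move=> xr; apply: ultra_lim_le (cvg_pexp xr) _; near=> n.
(* For n > 0 the constant term of the series cancels the 1. *)
have -> : n = n.-1.+1 by rewrite prednK//; near: n; exact: nbhs_infty_gt.
rewrite /series /= big_nat_recl// expr0 fact0 divr1 addrC addKr.
apply: vabs_sum_le => [|i _]; first exact: vabs_ge0.
rewrite (le_trans (vabs_exp_term_le p_prime vabs_p _ _))//.
rewrite ler_piMr ?vabs_ge0// exprn_ile1//;
  by case/andP: (ratio_bounds xr) => // ? /ltW.
Unshelve. all: by end_near. Qed.

Lemma pexp0 : pexp (0 : C) = 1.
Proof.
apply/eqP; rewrite -subr_eq0; apply/eqP/vabs0_eq0/eqP.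
by rewrite eq_le vabs_ge0 andbT -[leRHS](@vabs0 _ C) vabs_pexpB1// vabs0.
Qed.

Lemma pexp_natM n x : vabs x < rho -> pexp (n%:R * x) = pexp x ^+ n.
Proof.
move=> xr; elim: n => [|n IHn]; first by rewrite mul0r pexp0.
rewrite -natr1 mulrDl mul1r pexpD//; last first.
  exact: le_lt_trans (vabs_nat_mul _ _) xr.
by rewrite IHn exprSr.
Qed.

Lemma pexp_sum (I : Type) (s : seq I) (y : I -> C) :
  (forall i, vabs (y i) < rho) ->
  pexp (\sum_(i <- s) y i) = \prod_(i <- s) pexp (y i).
Proof.
move=> yr; elim: s => [|i s IHs]; first by rewrite !big_nil pexp0.
by rewrite !big_cons pexpD ?IHs// vabs_sum_lt.
Qed.

Lemma vabs_plog_le q : vabs (q - 1) < rho -> vabs (plog q) <= vabs (q - 1).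
Proof.
move=> qr; have r01 := ratio_bounds qr.
have dom : dominated (vabs (q - 1)) (vabs (q - 1) / rho)
    (fun n => (-1) ^+ n * (q - 1) ^+ n.+1 / n.+1%:R).
  move=> n; apply: le_trans (vabs_exp_term_le p_prime vabs_p _ _).
  have -> : (-1) ^+ n * (q - 1) ^+ n.+1 / n.+1%:R =
      (-1) ^+ n * n`!%:R * ((q - 1) ^+ n.+1 / n.+1`!%:R).
    have := natr_neq0 p_prime vabs_p (fact_gt0 n).
    have := natr_neq0 p_prime vabs_p (ltn0Sn n).
    rewrite factS natrM; move: n.+1%:R n`!%:R => a b a0 b0; field.
    by rewrite a0 b0.
  rewrite vabsM ler_piMl ?vabs_ge0// vabsM vabsX vabsN vabs1 expr1n mul1r.
  exact: vabs_nat_le1.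
rewrite -[plog q]subr0.
apply: ultra_lim_le (cvg_series_dominated complete r01 dom) _.
near=> n; rewrite subr0 /series /=.
apply: vabs_sum_le => [|i _]; first exact: vabs_ge0.
apply: le_trans (dom i) _.
by rewrite ler_piMr ?vabs_ge0// exprn_ile1//; case/andP: r01 => // ? /ltW.
Unshelve. all: by end_near. Qed.

(** The powers are exp (p^N x), with p^N x tending to 0. *)
Lemma cvg_pexp_expp x : vabs x < rho ->
  (fun N => pexp x ^+ (p ^ N)) @ \oo --> (1 : C).
Proof.
move=> xr.
have d0 : (fun N => vabs x * p%:R^-1 ^+ N) @ \oo --> (0 : R).
  apply: cvg_geometric0; rewrite invr_ge0 ler0n.
  by rewrite invf_lt1 ?ltr0n ?ltr1n ?prime_gt1 ?prime_gt0.
apply: cvg_vabs_le d0; near=> N; rewrite -pexp_natM//.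
rewrite (le_trans (vabs_pexpB1 _)) ?(le_lt_trans (vabs_nat_mul _ _))//.
by rewrite vabsM natrX vabsX vabs_p mulrC.
Unshelve. all: by end_near. Qed.

(** Here p is odd, so |2| = 1, whereas exp x is at distance less than 1
    from 1. *)
Lemma pexp_neqN1 x : odd p -> vabs x < rho -> 1 + pexp x != 0.
Proof.
move=> p_odd xr.
have v2 : vabs (2 : C) = 1.
  apply: (vabs_nat_coprime p_prime vabs_p); rewrite (@dvdn_prime2 _ 2)//.
  by apply: contraTneq p_odd => ->.
suff : vabs (1 + pexp x) = 1.
  by apply: contra_eqN => /eqP ->; rewrite vabs0 eq_sym oner_eq0.
rewrite -v2; apply: vabsB_lt_eq; rewrite v2.
have -> : 1 + pexp x - 2 = pexp x - 1 by ring.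
rewrite (le_lt_trans (vabs_pexpB1 xr))// (lt_trans xr)//.
exact: exp_radius_lt1.
Qed.

End Exponential.

(** * Fermionic integrals of geometric progressions *)

Section Fermionic.
Context {R : realType} {C : ultrametricFieldType R} (p : nat) (p_odd : odd p).
Implicit Types (c u : C).
Local Open Scope classical_set_scope.

(** The sums that define the integral sample f at natural numbers, so for this
    f they are geometric with ratio -u. *)
Lemma fermionic_geometric (f : Defs.Zp C -> C) c u :
  (forall n, f (@Defs.nat_Zp R C n) = c * u ^+ n) ->
  1 + u != 0 -> (fun N => u ^+ (p ^ N)) @ \oo --> (1 : C) ->
  fermionic p f = c * (2 / (1 + u)).
Proof.
move=> fE u1 uX; apply: ultra_cvg_lim.
have uD : (fun N => c / (1 + u) * (1 + u ^+ (p ^ N))) @ \oo -->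
    c / (1 + u) * (1 + 1).
  apply: (@ultra_cvgM _ _ (fun=> c / (1 + u)) (fun N => 1 + u ^+ (p ^ N))).
    exact: cvg_cst.
  by apply: (@ultra_cvgD _ _ (fun=> 1)) uX; exact: cvg_cst.
have -> : c * (2 / (1 + u)) = c / (1 + u) * (1 + 1) by field.
apply: cvg_trans uD; apply: near_eq_cvg; near=> N.
have -> : \sum_(0 <= x < p ^ N) f (nat_Zp C x) * (-1) ^+ x =
    c * \sum_(i < p ^ N) (- u) ^+ i.
  rewrite big_mkord mulr_sumr; apply: eq_bigr => i _.
  by rewrite fE -mulrA [(- u) ^+ _]exprNn [u ^+ _ * _]mulrC.
have := subrX1 (- u) (p ^ N); move: (\sum_(_ < _) _) => S.
rewrite exprNn -signr_odd oddX p_odd orbT expr1 => SE.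
have -> : S = (1 + u ^+ (p ^ N)) / (1 + u).
  apply: (mulIf u1); rewrite mulfVK//.
  have -> : S * (1 + u) = - ((- u - 1) * S) by ring.
  by rewrite -SE; ring.
by field.
Unshelve. all: by end_near. Qed.

(** The factor c is general because fixing the first variable at n turns it
    into c u^n. *)
Lemma fermionic_iter_geometric v (f : v.-tuple (Defs.Zp C) -> C) c u :
  (forall ns : v.-tuple nat,
    f [tuple of map (@Defs.nat_Zp R C) ns] = c * u ^+ sumn ns) ->
  1 + u != 0 -> (fun N => u ^+ (p ^ N)) @ \oo --> (1 : C) ->
  fermionic_iter p f = c * (2 / (1 + u)) ^+ v.
Proof.
move=> + u1 uX; elim: v f c => [|v IHv] f c fE /=.
  have := fE [tuple]; rewrite /= !expr0 => <-; congr f; exact: val_inj.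
rewrite (@fermionic_geometric _ (c * (2 / (1 + u)) ^+ v) u)//.
  by rewrite -mulrA -exprSr.
move=> n; rewrite mulrAC; apply: IHv => ns; rewrite -mulrA -exprD.
have := fE [tuple of n :: ns]; rewrite /= => <-; congr f; exact: val_inj.
Qed.

End Fermionic.

(** * Functions with a power series expansion at 0 *)

Section PowerSeries.
Context {R : realType} {C : ultrametricFieldType R}.
Context (complete :
  forall F : set_system C, ProperFilter F -> cauchy F -> cvg F).
Implicit Types (F G : C -> C) (a b c : nat -> C).
Local Open Scope classical_set_scope.

Lemma near0_vabs (e : R) : 0 < e -> \forall t \near (0 : C), vabs t < e.
Proof.
move=> e0; have := nbhsx_ballx (0 : C) e e0; apply: filterS => t.
rewrite ballEmdist; change (vabs (0 - t) < e -> vabs t < e).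
by rewrite sub0r vabsN.
Qed.

Lemma near0_ratio (r : R) : 0 <= r ->
  \forall t \near (0 : C), 0 <= r * vabs t < 1.
Proof.
move=> r0; have r1 : 0 < r + 1 by rewrite ltr_wpDl.
have : 0 < (r + 1)^-1 by rewrite invr_gt0.
move=> /near0_vabs; apply: filterS => t tr; rewrite mulr_ge0 ?vabs_ge0//=.
rewrite -[ltRHS](@mulfV _ (r + 1)) ?gt_eqF//.
rewrite (@le_lt_trans _ _ ((r + 1) * vabs t)) ?ltr_pM2l//.
by rewrite ler_wpM2r ?vabs_ge0// lerDl.
Qed.

(** The geometric bound on the coefficients is part of the definition: it is
    what makes products and inverses converge near 0, and carrying it along
    avoids extracting it from convergence each time. *)
Definition has_pseries F a :=
  (exists A r, 0 <= r /\ dominated A r a) /\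
  \forall t \near (0 : C), series (fun n => a n * t ^+ n) @ \oo --> F t.

Lemma has_pseries_egf F a : has_pseries F a ->
  (forall n, (n`!%:R : C) != 0) -> is_egf F (fun n => a n * n`!%:R).
Proof.
move=> [_ aF] nz; apply: filterS aF => t.
have -> // : (fun n => a n * n`!%:R * (t ^+ n / n`!%:R)) =
    (fun n => a n * t ^+ n).
by apply/funext => n; rewrite -mulrA [_ * (_ / _)]mulrC divfK.
Qed.

Lemma dominated_term A r a (t : C) :
  dominated A r a -> dominated A (r * vabs t) (fun n => a n * t ^+ n).
Proof.
by move=> da n; rewrite vabsM vabsX exprMn mulrA ler_wpM2r ?exprn_ge0 ?vabs_ge0.
Qed.

Lemma dominated_le A r r' a :
  0 <= r <= r' -> dominated A r a -> dominated A r' a.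
Proof.
move=> /andP[r0 rr'] da n; apply: le_trans (da n) _.
rewrite ler_wpM2l ?(dominated_ge0 da)//.
by apply: lerXn2r; rewrite ?nnegrE// (le_trans r0).
Qed.

Lemma has_pseries_lim A r a : 0 <= r -> dominated A r a ->
  has_pseries (fun t => limn (series (fun n => a n * t ^+ n))) a.
Proof.
move=> r0 da; split; first by exists A, r.
apply: filterS (near0_ratio r0) => t rt.
exact: (cvg_series_dominated complete rt (dominated_term t da)).
Qed.

Lemma cauchy_prod_term a b (t : C) :
  cauchy_prod (fun n => a n * t ^+ n) (fun n => b n * t ^+ n) =
  (fun n => cauchy_prod a b n * t ^+ n).
Proof.
apply/funext => n; rewrite /cauchy_prod mulr_suml; apply: eq_bigr => k _.
by rewrite mulrACA -exprD subnKC// -ltnS.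
Qed.

Lemma has_pseriesM F G a b : has_pseries F a -> has_pseries G b ->
  has_pseries (fun t => F t * G t) (cauchy_prod a b).
Proof.
move=> [[A [r [r0 da]]] aF] [[B [r' [r'0 db]]] bG].
pose s := Num.max r r'.
have s0 : 0 <= s by rewrite le_max r0.
have das : dominated A s a by apply: dominated_le da; rewrite r0 le_max lexx.
have dbs : dominated B s b.
  by apply: dominated_le db; rewrite r'0 le_max lexx orbT.
split; first by exists (A * B), s; split=> //; exact: dominated_cauchy_prod.
near=> t; rewrite -cauchy_prod_term.
apply: cvg_series_cauchy_prod (dominated_term t das) (dominated_term t dbs) _ _.
- by near: t; exact: near0_ratio.
- by near: t.
- by near: t.
Unshelve. all: by end_near. Qed.

Lemma has_pseries_cst (x : C) :
  has_pseries (fun=> x) (fun n => if n is 0 then x else 0).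
Proof.
split.
  exists (vabs x), 0; split=> // -[|n]; first by rewrite expr0 mulr1.
  by rewrite vabs0 mulr_ge0 ?vabs_ge0 ?exprn_ge0.
near=> t; apply: cvg_near_cst; near=> n.
have -> : n = n.-1.+1 by rewrite prednK//; near: n; exact: nbhs_infty_gt.
rewrite /series /= big_nat_recl// expr0 mulr1 big1 ?addr0// => i _.
exact: mul0r.
Unshelve. all: by end_near. Qed.

Lemma has_pseriesD F G a b : has_pseries F a -> has_pseries G b ->
  has_pseries (fun t => F t + G t) (fun n => a n + b n).
Proof.
move=> [[A [r [r0 da]]] aF] [[B [r' [r'0 db]]] bG]; split.
  exists (Num.max A B), (Num.max r r'); split; first by rewrite le_max r0.
  have domle A' r'' (c : nat -> C) :
      0 <= r'' <= Num.max r r' -> A' <= Num.max A B ->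
      dominated A' r'' c -> dominated (Num.max A B) (Num.max r r') c.
    move=> rr AA dc n; rewrite (le_trans (dominated_le rr dc n))// ler_wpM2r//.
    by rewrite exprn_ge0// le_max r0.
  move=> n; rewrite (le_trans (vabsD_max _ _))// ge_max.
  rewrite (domle _ _ _ _ _ da) ?(domle _ _ _ _ _ db)//;
    by rewrite ?r0 ?r'0 le_max lexx ?orbT.
near=> t.
have -> : series (fun n => (a n + b n) * t ^+ n) =
    (fun n => series (fun k => a k * t ^+ k) n +
              series (fun k => b k * t ^+ k) n).
  apply/funext => n; rewrite /series /= -big_split /=.
  by apply: eq_bigr => k _; rewrite mulrDl.
by apply: ultra_cvgD; near: t.
Unshelve. all: by end_near. Qed.

(** The first n coefficients of 1 / F, where F has coefficients a: the n-th one
    depends on all the previous ones, hence the list. *)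
Fixpoint inv_prefix a n : seq C :=
  if n is m.+1 then
    let s := inv_prefix a m in
    rcons s (((m == 0%N)%:R - \sum_(k < m) s`_k * a (m - k)%N) / a 0%N)
  else [::].

Definition inv_coef a n := (inv_prefix a n.+1)`_n.

Lemma size_inv_prefix a n : size (inv_prefix a n) = n.
Proof. by elim: n => //= n IHn; rewrite size_rcons IHn. Qed.

Lemma nth_inv_prefix a n k : (k < n)%N -> (inv_prefix a n)`_k = inv_coef a k.
Proof.
elim: n => // n IHn; rewrite ltnS leq_eqVlt => /predU1P[->//|kn].
by rewrite /= nth_rcons size_inv_prefix kn IHn.
Qed.

Lemma inv_coefE a n :
  inv_coef a n =
  ((n == 0%N)%:R - \sum_(k < n) inv_coef a k * a (n - k)%N) / a 0%N.
Proof.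
rewrite {1}/inv_coef /= nth_rcons size_inv_prefix ltnn eqxx.
by congr ((_ - _) / _); apply: eq_bigr => k _; rewrite nth_inv_prefix.
Qed.

Lemma cauchy_prod_inv_coef a : a 0%N != 0 ->
  cauchy_prod (inv_coef a) a = (fun n => if n is 0 then 1 else 0).
Proof.
move=> a0; apply/funext => n; rewrite /cauchy_prod big_ord_recr /= subnn.
by rewrite [inv_coef a n]inv_coefE mulfVK// addrC subrK; case: n.
Qed.

(** In the recursion every summand is b_k a_(n-k) / a_0 with k < n. Put
    A' = A / |a_0|, which is at least 1 because |a_0| <= A; then for i > 0,
    |a_i / a_0| <= A' r^i <= (A' r)^i, so the bound (A' r)^n / |a_0| is
    reproduced by induction without any loss, the sum being bounded by its
    largest term. *)
Lemma dominated_inv_coef A r a : 0 <= r -> a 0%N != 0 -> dominated A r a ->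
  dominated (vabs (a 0%N))^-1 (A / vabs (a 0%N) * r) (inv_coef a).
Proof.
move=> r0 a0 da; have va := vabs_gt0 a0.
set A' := A / vabs (a 0%N).
have A1 : 1 <= A'.
  by rewrite ler_pdivlMr// mul1r; have := da 0%N; rewrite expr0 mulr1.
have A0 : 0 <= A' by rewrite (le_trans _ A1).
elim/ltn_ind => -[_|n IHn].
  by rewrite inv_coefE big_ord0 subr0 eqxx mul1r vabsV expr0 mulr1.
rewrite inv_coefE sub0r vabsM vabsV vabsN mulrC ler_wpM2l ?invr_ge0 ?vabs_ge0//.
apply: vabs_sum_le => [|k _]; first by rewrite exprn_ge0// mulr_ge0.
have -> : (A' * r) ^+ n.+1 = (vabs (a 0%N))^-1 * (A' * r) ^+ k *
    (vabs (a 0%N) * (A' * r) ^+ (n.+1 - k)).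
  rewrite mulrACA mulVf ?gt_eqF// mul1r -exprD subnKC//.
  by rewrite ltnW.
rewrite vabsM; apply: ler_pM; rewrite ?vabs_ge0 ?IHn//.
apply: le_trans (da _) _.
rewrite exprMn mulrA ler_wpM2r ?exprn_ge0//.
rewrite -ler_pdivrMl// mulrC -/A' subSn; last by rewrite -ltnS.
by rewrite exprS ler_peMr// exprn_ege1.
Qed.

(** The formal inverse converges to some function near 0, whose product with F
    is 1 there. *)
Lemma has_pseriesV F a : has_pseries F a -> a 0%N != 0 ->
  exists b, has_pseries (fun t => (F t)^-1) b.
Proof.
move=> [[A [r [r0 da]]] aF] a0.
have F0 : has_pseries F a by split => //; exists A, r.
exists (inv_coef a).
have dV := dominated_inv_coef r0 a0 da.
have va := vabs_gt0 a0.
have rV0 : 0 <= A / vabs (a 0%N) * r.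
  by rewrite mulr_ge0// divr_ge0 ?vabs_ge0 ?(dominated_ge0 da).
have GV := has_pseries_lim rV0 dV.
split; first by exists (vabs (a 0%N))^-1, (A / vabs (a 0%N) * r).
have [_ GF1] := has_pseriesM GV F0.
have [_ c1] := has_pseries_cst 1.
rewrite cauchy_prod_inv_coef// in GF1; case: GV => _.
apply: filterS3 GF1 c1 => t GF1 c1; have GF := ultra_cvg_unique GF1 c1.
rewrite -[(F t)^-1]mul1r -GF mulfK//.
by apply: contra_eq_neq GF => ->; rewrite mulr0 eq_sym oner_eq0.
Qed.

(** Truncating all factors at a common degree N lets the arithmetic of
    polynomials compute the first N coefficients of an iterated Cauchy
    product. *)
Lemma has_pseries_prod (I : Type) (s : seq I) (F : I -> C -> C)
    (a : I -> nat -> C) N :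
  (forall j, has_pseries (F j) (a j)) ->
  exists2 c, has_pseries (fun t => \prod_(j <- s) F j t) c &
    forall n, (n < N)%N -> c n = (\prod_(j <- s) \poly_(i < N) a j i)`_n.
Proof.
move=> Fa; elim: s => [|j s [c Fc cE]].
  exists (fun n => if n is 0 then 1 else 0).
    under [X in has_pseries X]funext do rewrite big_nil.
    exact: has_pseries_cst.
  by move=> [|n] _; rewrite big_nil coef1.
exists (cauchy_prod (a j) c).
  under [X in has_pseries X]funext do rewrite big_cons.
  exact: has_pseriesM.
move=> n nN; rewrite big_cons coefM; apply: eq_bigr => k _.
have kN : (k < N)%N by apply: leq_trans nN; rewrite ltnS -ltnS.
by rewrite coef_poly kN cE// (leq_ltn_trans (leq_subr _ _)).
Qed.

(** Let c_m be the first nonzero coefficient and t0 = e^N a point of the disc,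
    where the terms are bounded by some M. At e^k t0 the later terms are at
    most M |e|^(k (m+1)), while the m-th one is |c_m t0^m| |e|^(k m); as they
    add up to 0, |c_m t0^m| <= M |e|^k for every k. The element e ensures that
    the absolute value is not trivial: otherwise 0 would be an isolated point
    and the expansion would say nothing about the later coefficients. *)
Lemma pseries_eq0 (e : C) c : 0 < vabs e < 1 ->
  (\forall t \near (0 : C), series (fun n => c n * t ^+ n) @ \oo --> (0 : C)) ->
  forall n, c n = 0.
Proof.
move=> /andP[e0 e1] /nbhs_ballP[d /= d0 cd].
have {}cd (t : C) :
    vabs t < d -> series (fun n => c n * t ^+ n) @ \oo --> (0 : C).
  move=> td; apply: cd; rewrite ballEmdist; change (vabs (0 - t) < d).
  by rewrite sub0r vabsN.
have [N eN] : exists N, vabs (e ^+ N) < d.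
  have /cvgrPdist_lt/(_ d d0)[N _ /(_ N (leqnn N))] :
      (fun n => 1 * vabs e ^+ n) @ \oo --> (0 : R).
    by apply: cvg_geometric0; rewrite e1 ltW.
  rewrite mul1r sub0r normrN ger0_norm ?exprn_ge0 ?vabs_ge0// -vabsX.
  by exists N.
set t0 := e ^+ N in eN.
have t0_neq0 : t0 != 0.
  by rewrite expf_neq0//; apply: contraTneq e0 => ->; rewrite vabs0 ltxx.
have [M cM] : exists M, forall n, vabs (c n * t0 ^+ n) <= M.
  have /cvg_vabsP/cvgP/cvg_seq_bounded[M [_ /(_ (M + 1))]] := cd _ eN.
  rewrite ltrDl => /(_ ltr01) sM; exists (M + 1) => n.
  (* A term is a difference of partial sums, and these are bounded. *)
  have -> : c n * t0 ^+ n = (series (fun n => c n * t0 ^+ n) n.+1 - 0)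
      - (series (fun n => c n * t0 ^+ n) n - 0).
    by rewrite seriesSr !subr0 addrAC subrr add0r.
  rewrite (le_trans (vabsD_max _ _))// vabsN ge_max.
  have sn k : vabs (series (fun n => c n * t0 ^+ n) k - 0) <= M + 1.
    by rewrite -[leLHS]ger0_norm ?vabs_ge0//; apply: sM.
  by rewrite !sn.
have M0 : 0 <= M := le_trans (vabs_ge0 _) (cM 0%N).
elim/ltn_ind => m IHm.
suff : c m * t0 ^+ m = 0.
  by move/eqP; rewrite mulf_eq0 expf_eq0 (negPf t0_neq0) andbF orbF => /eqP.
apply: (@ultra_cvg_unique _ _ (fun=> c m * t0 ^+ m)); first exact: cvg_cst.
have d0' : (fun k => M * vabs e ^+ k) @ \oo --> (0 : R).
  by apply: cvg_geometric0; rewrite e1 ltW.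
apply: cvg_vabs_le d0'; near=> k; rewrite subr0.
have ek : vabs (e ^+ k) <= 1 by rewrite vabsX exprn_ile1 ?vabs_ge0 ?ltW.
have td : vabs (e ^+ k * t0) < d.
  by rewrite vabsM (le_lt_trans _ eN)// ler_piMl ?vabs_ge0.
have termE n : vabs (c n * (e ^+ k * t0) ^+ n) =
    vabs (c n * t0 ^+ n) * vabs (e ^+ k) ^+ n.
  by rewrite -vabsX -vabsM exprMn mulrCA mulrC.
have ek0 : 0 < vabs (e ^+ k) by rewrite vabsX exprn_gt0.
rewrite -(ler_pM2r (exprn_gt0 m ek0)) -termE -[vabs e ^+ k]vabsX.
rewrite -[leRHS]mulrA -exprS.
rewrite -vabsN -sub0r; apply: ultra_lim_le (cd _ td) _; near=> n.
rewrite /series /= (big_cat_nat (n := m.+1))//=; last first.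
  by near: n; exact: nbhs_infty_ge.
rewrite big_nat_recr//= big_nat big1 ?add0r => [|i /andP[_ im]]; last first.
  by rewrite IHm ?mul0r.
rewrite addrAC subrr add0r big_nat; apply: vabs_sum_le => [|i /andP[mi _]].
  by rewrite mulr_ge0 ?exprn_ge0 ?vabs_ge0.
by rewrite termE ler_pM ?vabs_ge0 ?exprn_ge0 ?vabs_ge0// ler_wiXn2l ?vabs_ge0.
Unshelve. all: by end_near. Qed.

Lemma egf_coefE (e : C) F a : 0 < vabs e < 1 -> (forall n, (n`!%:R : C) != 0) ->
  is_egf F a -> egf_coef F = a.
Proof.
move=> e01 nz Fa; apply: get_unique => // b Fb; apply/funext => n.
suff /(_ n) : forall n, (b n - a n) / n`!%:R = 0.
  by move/eqP; rewrite mulf_eq0 invr_eq0 (negPf (nz n)) orbF subr_eq0 => /eqP.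
apply: pseries_eq0 e01 _; apply: filterS2 Fa Fb => t at_ bt.
have m1 : (fun _ : nat => -1 : C) @ \oo --> (-1 : C) by exact: cvg_cst.
have := ultra_cvgD bt (ultra_cvgM m1 at_).
rewrite mulN1r subrr; apply: cvg_trans; apply: near_eq_cvg; near=> k.
rewrite mulN1r /series /= -sumrB; apply: eq_bigr => i _.
by rewrite -mulrA [_ / _]mulrC mulrBl mulrA.
Unshelve. all: by end_near. Qed.

End PowerSeries.

(** * Multinomial coefficients and products of polynomials *)

Section Multinomial.

Lemma prod_fact_dvdn (I : Type) (s : seq I) (l : I -> nat) :
  (\prod_(j <- s) (l j)`! %| (\sum_(j <- s) l j)`!)%N.
Proof.
elim: s => [|j s IHs]; first by rewrite !big_nil.
rewrite !big_cons -(bin_fact (leq_addr (\sum_(i <- s) l i) (l j))) addKn.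
by rewrite dvdn_mull// dvdn_mul.
Qed.

Lemma multinomial_fact (n v : nat) (l : 'I_v -> nat) :
  (\sum_(j < v) l j)%N = n ->
  (multinomial n l * \prod_(j < v) (l j)`! = n`!)%N.
Proof. by move=> <-; rewrite divnK// prod_fact_dvdn. Qed.

Lemma coef_prod_poly (A : comNzRingType) (n v : nat) (a : 'I_v -> nat -> A) :
  (\prod_(j < v) \poly_(i < n.+1) a j i)`_n =
  \sum_(l : {ffun 'I_v -> 'I_n.+1} | (\sum_(j < v) l j)%N == n)
    \prod_(j < v) a j (l j).
Proof.
under eq_bigr do rewrite poly_def.
rewrite bigA_distr_bigA coef_sum [RHS]big_mkcond; apply: eq_bigr => l _.
rewrite scaler_prod prodrXr coefZ coefXn eq_sym.
by case: eqP; rewrite ?mulr1 ?mulr0.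
Qed.

End Multinomial.

(** * Generating functions of Euler polynomials *)

Section EulerPolynomials.
Context {R : realType} {C : ultrametricFieldType R} (p : nat).
Context (p_prime : prime p) (p_odd : odd p) (hC : is_padic_complex p C).
Local Open Scope classical_set_scope.
Local Notation rho := (exp_radius p : R).

Let vabs_p := vabs_p hC.
Let complete := padic_complete hC.
Let rho_gt0 : 0 < rho. Proof. exact: exp_radius_gt0. Qed.

Lemma near0_pexp (y : C) : \forall t \near (0 : C), vabs (t * y) < rho.
Proof.
have : 0 < rho / (vabs y + 1) by rewrite divr_gt0// ltr_wpDl ?vabs_ge0.
move=> /(@near0_vabs _ C); apply: filterS => t.
rewrite ltr_pdivlMr ?ltr_wpDl ?vabs_ge0// vabsM; apply: le_lt_trans.
by rewrite ler_wpM2l ?vabs_ge0// lerDl.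
Qed.

Lemma has_pseries_pexp (y : C) :
  has_pseries (fun t => pexp (t * y)) (fun n => y ^+ n / n`!%:R).
Proof.
split.
  exists 1, (vabs y / rho); split; first by rewrite divr_ge0 ?vabs_ge0 ?ltW.
  exact: dominated_exp.
apply: filterS (near0_pexp y) => t /(cvg_pexp p_prime vabs_p complete).
have -> // : (fun n => y ^+ n / n`!%:R * t ^+ n) =
    (fun n => (t * y) ^+ n / n`!%:R).
by apply/funext => n; rewrite exprMn mulrAC [y ^+ n * _]mulrC.
Qed.

Section EulerParameter.
Context (q : C) (h : int) (hq : vabs (q - 1) < rho).
Local Notation w := (qpow q h%:~R).

(** So qpow q h lies in the image of the disc of convergence. *)
Lemma vabs_int_plog_lt : vabs (h%:~R * plog q) < rho.
Proof.
rewrite vabsM (le_lt_trans _ hq)//.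
apply: le_trans (vabs_plog_le p_prime vabs_p complete hq).
by rewrite ler_piMl ?vabs_ge0// vabs_int_le1.
Qed.

(** The denominator is invertible at 0, where its value is 1 + exp (h log q). *)
Lemma has_pseries_euler (y : C) :
  exists a, has_pseries (fun t => 2 * pexp (t * y) / (w * pexp t + 1)) a.
Proof.
have den : has_pseries (fun t => w * pexp (t * 1) + 1) _ :=
  has_pseriesD (has_pseriesM (has_pseries_cst w) (has_pseries_pexp 1))
    (has_pseries_cst 1).
have [|b] := has_pseriesV complete den.
  rewrite /cauchy_prod big_ord_recl big_ord0 /= expr0 fact0 divr1 mulr1 addr0.
  rewrite addrC; exact: pexp_neqN1 p_odd vabs_int_plog_lt.
under [X in has_pseries X]funext do rewrite mulr1.
move=> wb; eexists.
exact: has_pseriesM (has_pseriesM (has_pseries_cst 2) (has_pseries_pexp y)) wb.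
Qed.

(** At natural numbers the integrand is e^(tz) u^(x_1 + ... + x_v) with
    u = w e^t, and u is itself an exponential, of h log q + t. *)
Lemma fermionic_iter_euler v (z t : C) :
  vabs (t * z) < rho -> vabs t < rho ->
  fermionic_iter p (fun x : v.-tuple (Defs.Zp C) =>
    qpow q (\sum_(j < v) h%:~R * set_val (tnth x j)) *
    pexp (t * z + \sum_(j < v) t * set_val (tnth x j))) =
  pexp (t * z) * (2 / (w * pexp t + 1)) ^+ v.
Proof.
move=> tz tr; have hl := vabs_int_plog_lt.
have wE : w * pexp t = pexp (h%:~R * plog q + t).
  by rewrite (pexpD p_prime vabs_p).
have str : vabs (h%:~R * plog q + t) < rho.
  by rewrite (le_lt_trans (vabsD_max _ _))// gt_max hl.
rewrite addrC wE; apply: fermionic_iter_geometric => //.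
- move=> ns.
  have sumE (x : C) :
      \sum_(j < v) x * set_val (tnth [tuple of map (nat_Zp C) ns] j) =
      (sumn ns)%:R * x.
    rewrite sumnE big_tuple natr_sum mulr_suml; apply: eq_bigr => j _.
    by rewrite tnth_map mulrC.
  rewrite !sumE /qpow -mulrA.
  have ltr_nat (x : C) m : vabs x < rho -> vabs (m%:R * x) < rho.
    exact: le_lt_trans (vabs_nat_mul _ _).
  rewrite (pexpD p_prime vabs_p)//; last exact: ltr_nat.
  rewrite mulrCA; congr (_ * _).
  rewrite -(pexpD p_prime vabs_p)//; try exact: ltr_nat.
  by rewrite -mulrDr (pexp_natM p_prime vabs_p).
- exact: pexp_neqN1 p_odd str.
- exact: cvg_pexp_expp str.
Qed.

End EulerParameter.
End EulerPolynomials.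

Theorem theorem8 (R : realType) (p : nat) (p_prime : prime p) (p_odd : odd p)
    (C : ultrametricFieldType R) (hC : is_padic_complex p C) (q : C)
    (hq : vabs (q - 1) < (p%:R : R) `^ (- (p.-1%:R)^-1))
    (h : int) (n v : nat) (n_gt0 : (0 < n)%N) (v_gt0 : (0 < v)%N)
    (y : 'I_v -> C) :
  euler_higher p q h v n (\sum_(j < v) y j) =
  \sum_(l : {ffun 'I_v -> 'I_n.+1} | (\sum_(j < v) l j)%N == n)
    (multinomial n (fun j => l j))%:R * \prod_(j < v) euler q h (l j) (y j).
Proof.
have vp := vabs_p hC; have complete := padic_complete hC.
have nz m : (m`!%:R : C) != 0 by rewrite (natr_neq0 p_prime vp)// fact_gt0.
have p01 : 0 < vabs (p%:R : C) < 1.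
  by rewrite vp invr_gt0 invf_lt1 ?ltr0n ?ltr1n ?prime_gt0 ?prime_gt1.
have [a ya] := choice (fun j => has_pseries_euler p_prime p_odd hC h hq (y j)).
have eulerE m j : euler q h m (y j) = a j m * m`!%:R.
  by rewrite /euler (egf_coefE p01 nz (has_pseries_egf (ya j) nz)).
have [c Fc cE] := has_pseries_prod (index_enum 'I_v) n.+1 ya.
have -> : euler_higher p q h v n (\sum_(j < v) y j) = c n * n`!%:R.
  rewrite /euler_higher (egf_coefE p01 nz (a := fun n => c n * n`!%:R))//.
  have Ft := has_pseries_egf Fc nz.
  have r0 : 0 < (exp_radius p : R) by exact: exp_radius_gt0.
  have tyr : \forall t \near (0 : C),
      forall j, vabs (t * y j) < (exp_radius p : R).
    apply: (@filter_forall _ _ (fun j t => vabs (t * y j) < exp_radius p)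
      _ (nbhs_filter (0 : C))) => j.
    exact: near0_pexp.
  (* Near 0 all the exponentials involved converge, and the integral is the
     product of the generating functions of the factors. *)
  apply: filterS3 (@near0_vabs _ C _ r0) tyr Ft => t tr ty.
  have pexpE : pexp (t * \sum_(j < v) y j) = \prod_(j < v) pexp (t * y j).
    by rewrite mulr_sumr (pexp_sum p_prime vp complete).
  rewrite (fermionic_iter_euler p_prime p_odd hC h hq)//; last first.
    by rewrite mulr_sumr vabs_sum_lt.
  under eq_bigr do rewrite [2 * _]mulrC -mulrA.
  by rewrite big_split /= prodr_const card_ord pexpE.
rewrite cE// coef_prod_poly mulr_suml; apply: eq_bigr => l /eqP ln.
rewrite -(multinomial_fact ln) natrM natr_prod mulrCA; congr (_ * _).
by rewrite -big_split; apply: eq_bigr => j _; rewrite eulerE.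
Qed.
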